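(* Let $\mathcal C,\mathcal D$ be stable configuration structures. Then $\mathcal C$ and $\mathcal D$ are history-preserving (H) bisimilar if and only if $\mathcal C\equiv_{\mathrm{EIL}_h}\mathcal D$.
   Context: Configuration structures. A configuration structure over a label alphabet $\mathsf{Act}$ is a pair $\mathcal C=(C,\ell)$ where $C$ is a family of finite sets (configurations) and $\ell:\bigcup_{X\in C}X\to\mathsf{Act}$; $E_{\mathcal C}=\bigcup_{X\in C}X$. It is stable if: $\emptyset\in C$; every nonempty $X\in C$ has some $e\in X$ with $X\setminus\{e\}\in C$; whenever $X,Y,Z\in C$ with $X\cup Y\subseteq Z$, both $X\cup Y\in C$ and $X\cap Y\in C$. For $X\in C$: $d\le_X e$ iff for all $Y\in C$, $Y\subseteq X$, $e\in Y$ implies $d\in Y$; $d<_X e$ iff $d\le_X e$, $d\ne e$. $X\xrightarrow{e}X'$ iff $X,X'\in C$, $X\subseteq X'$, $X'\setminus X=\{e\}$; $X\xrightarrow{a}X'$ iff $X\xrightarrow{e}X'$ with $\ell(e)=a$. Standing assumption: image finiteness ($\{X':X\xrightarrow{a}X'\}$ finite for all $X,a$). $f:X\cong Y$ means $f$ is a label-preserving bijection with $d<_Xe\iff f(d)<_Yf(e)$. H bisimulation. $\mathcal R\subseteq C_{\mathcal C}\times C_{\mathcal D}\times\mathcal P(E_{\mathcal C}\times E_{\mathcal D})$ is an H bisimulation if $\mathcal R(\emptyset,\emptyset,\emptyset)$ and whenever $\mathcal R(X,Y,f)$, $a\in\mathsf{Act}$: $f:X\cong Y$; if $X\xrightarrow{a}X'$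 then there are $Y',f'$ with $Y\xrightarrow{a}Y'$, $\mathcal R(X',Y',f')$, $f'\restriction X=f$; symmetrically for $Y\xrightarrow{a}Y'$. EIL. Syntax $\phi::=\mathrm{tt}\mid\neg\phi\mid\phi\wedge\phi'\mid\langle x:a\rangle\phi\mid(x:a)\phi\mid\langle\!\langle x\rangle\!\rangle\phi$, where $\langle x:a\rangle$ and $(x:a)$ bind $x$; free identifiers $\mathrm{fi}$ defined as usual with $\mathrm{fi}(\langle\!\langle x\rangle\!\rangle\phi)=\mathrm{fi}(\phi)\cup\{x\}$; closed means no free identifiers. An environment $\rho$ (partial map identifiers $\to$ events) is permissible for $\phi$ and $X$ if $\mathrm{fi}(\phi)\subseteq\mathrm{dom}\rho$ and $\rho(\mathrm{fi}(\phi))\subseteq X$. Semantics: $\mathrm{tt}$ always holds, $\neg,\wedge$ classical; $X,\rho\models\langle x:a\rangle\phi$ iff $\exists X',e$: $X\xrightarrow{e}X'$, $\ell(e)=a$, $X',\rho[x\mapsto e]\models\phi$; $X,\rho\models(x:a)\phi$ iff $\exists e\in X$, $\ell(e)=a$, $X,\rho[x\mapsto e]\models\phi$; $X,\rho\models\langle\!\langle x\rangle\!\rangle\phi$ iff $\exists X',e$: $X'\xrightarrow{e}X$, $\rho(x)=e$, $\rho$ permissible for $\phi$ and $X'$, $X',\rho\models\phi$. For closed $\phi$, $\mathcal C\models\phi$ iff $\emptyset,\emptyset\models\phi$. $\mathcal C\equiv_L\mathcal D$ iff all closed $\phi\in L$ are satisfied by both or neither. Sublogics. $\mathrm{EIL}_{ro}$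 (reverse-only): $\phi::=\mathrm{tt}\mid\neg\phi\mid\phi\wedge\phi'\mid(x:a)\phi\mid\langle\!\langle x\rangle\!\rangle\phi$. $\mathrm{EIL}_h$: $\phi::=\mathrm{tt}\mid\neg\phi\mid\phi\wedge\phi'\mid\langle x:a\rangle\phi\mid(x:a)\phi\mid\phi_r$ where $\phi_r$ ranges over formulas of $\mathrm{EIL}_{ro}$ (so no forward modality occurs inside a reverse modality). *)

(* Defs.v *)
From mathcomp Require Import all_boot.
From mathcomp Require Import boolp classical_sets functions cardinality.

Set Implicit Arguments.
Unset Strict Implicit.
Unset Printing Implicit Defensive.

Local Open Scope classical_set_scope.

(* [event] is an ambient type: the events of the structure are the elements of
   configurations, and the values of [label] elsewhere are never used. *)
Record config_struct (Act : Type) := ConfigStruct {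
  event : Type;
  config : set (set event);
  label : event -> Act;
  config_finite : forall X, config X -> finite_set X
}.

Arguments config {Act} c _.

Section ConfigStruct.
Variables (Act : Type) (C : config_struct Act).
Implicit Types (X Y Z : set (event C)) (d e : event C) (a : Act).

Definition stable : Prop :=
  [/\ config C set0,
      forall X, config C X -> X !=set0 -> exists2 e, X e & config C (X `\ e)
    & forall X Y Z, config C X -> config C Y -> config C Z ->
        X `|` Y `<=` Z -> config C (X `|` Y) /\ config C (X `&` Y)].

Definition causal_le X d e : Prop :=
  forall Y, config C Y -> Y `<=` X -> Y e -> Y d.

Definition causal_lt X d e : Prop := causal_le X d e /\ d <> e.

Definition event_trans X e X' : Prop :=
  [/\ config C X, config C X', X `<=` X' & X' `\` X = [set e]].

Definition label_trans X a X' : Prop :=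
  exists2 e, event_trans X e X' & label e = a.

Definition image_finite : Prop :=
  forall X a, config C X -> finite_set [set X' | label_trans X a X'].

End ConfigStruct.

Section HBisimulation.
Variables (Act : Type) (C D : config_struct Act).

(* Functions between configurations are given by their graphs, which avoids
   extending them to the ambient event types (one of which may be empty). *)
Definition config_iso (X : set (event C)) (Y : set (event D))
    (f : set (event C * event D)) : Prop :=
  [/\ f `<=` X `*` Y,
      forall e, X e -> exists! e', f (e, e'),
      forall e', Y e' -> exists! e, f (e, e'),
      forall e e', f (e, e') -> label e = label e'
    & forall d e d' e', f (d, d') -> f (e, e') ->
        (causal_lt X d e <-> causal_lt Y d' e')].

Definition graph_restr (f : set (event C * event D)) (X : set (event C)) :
    set (event C * event D) :=
  f `&` (X `*` setT).

Definition H_bisimulation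
    (R : set (event C) -> set (event D) -> set (event C * event D) -> Prop) :
    Prop :=
  [/\ forall X Y f, R X Y f -> config C X /\ config D Y,
      R set0 set0 set0
    & forall X Y f (a : Act), R X Y f ->
      [/\ config_iso X Y f,
          forall X', label_trans X a X' ->
            exists Y' f',
              [/\ label_trans Y a Y', R X' Y' f' & graph_restr f' X = f]
        & forall Y', label_trans Y a Y' ->
            exists X' f',
              [/\ label_trans X a X', R X' Y' f' & graph_restr f' X = f]]].

Definition H_bisimilar : Prop := exists R, H_bisimulation R.

End HBisimulation.

Definition ident := nat.

Inductive EIL (Act : Type) : Type :=
| Tt
| Neg of EIL Act
| And of EIL Act & EIL Act
| Forward of ident & Act & EIL Act      (* <x : a> phi *)
| Declare of ident & Act & EIL Act      (* (x : a) phi *)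
| Reverse of ident & EIL Act.           (* <<x>> phi *)

Arguments Tt {Act}.

Fixpoint fi (Act : Type) (phi : EIL Act) : set ident :=
  match phi with
  | Tt => set0
  | Neg phi => fi phi
  | And phi psi => fi phi `|` fi psi
  | Forward x _ phi => fi phi `\ x
  | Declare x _ phi => fi phi `\ x
  | Reverse x phi => fi phi `|` [set x]
  end.

Definition closed_formula (Act : Type) (phi : EIL Act) : Prop := fi phi = set0.

Section Semantics.
Variables (Act : Type) (C : config_struct Act).

Definition env := ident -> option (event C).

Definition empty_env : env := fun=> None.

Definition update (rho : env) (x : ident) (e : event C) : env :=
  fun y => if y == x then Some e else rho y.

Definition permissible (rho : env) (phi : EIL Act) (X : set (event C)) : Prop :=
  forall x, fi phi x -> exists2 e, rho x = Some e & X e.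

(* Total in [X] and [rho]; only meaningful when [X] is a configuration and
   [rho] is permissible for the formula and [X].  The clauses preserve this, so
   it holds at all subformulas when a closed formula is evaluated at [set0]. *)
Fixpoint sat (X : set (event C)) (rho : env) (phi : EIL Act) : Prop :=
  match phi with
  | Tt => True
  | Neg phi => ~ sat X rho phi
  | And phi psi => sat X rho phi /\ sat X rho psi
  | Forward x a phi => exists X' e,
      [/\ event_trans X e X', label e = a & sat X' (update rho x e) phi]
  | Declare x a phi => exists e,
      [/\ X e, label e = a & sat X (update rho x e) phi]
  | Reverse x phi => exists X' e,
      [/\ event_trans X' e X, rho x = Some e, permissible rho phi X'
        & sat X' rho phi]
  end.

Definition models (phi : EIL Act) : Prop := sat set0 empty_env phi.

End Semantics.

Inductive EIL_ro (Act : Type) : EIL Act -> Prop :=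
| ro_Tt : EIL_ro Tt
| ro_Neg phi : EIL_ro phi -> EIL_ro (Neg phi)
| ro_And phi psi : EIL_ro phi -> EIL_ro psi -> EIL_ro (And phi psi)
| ro_Declare x a phi : EIL_ro phi -> EIL_ro (Declare x a phi)
| ro_Reverse x phi : EIL_ro phi -> EIL_ro (Reverse x phi).

Inductive EIL_h (Act : Type) : EIL Act -> Prop :=
| h_Tt : EIL_h Tt
| h_Neg phi : EIL_h phi -> EIL_h (Neg phi)
| h_And phi psi : EIL_h phi -> EIL_h psi -> EIL_h (And phi psi)
| h_Forward x a phi : EIL_h phi -> EIL_h (Forward x a phi)
| h_Declare x a phi : EIL_h phi -> EIL_h (Declare x a phi)
| h_ro phi : EIL_ro phi -> EIL_h phi.

Definition logic_equiv (Act : Type) (L : EIL Act -> Prop)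
    (C D : config_struct Act) : Prop :=
  forall phi, L phi -> closed_formula phi -> (models C phi <-> models D phi).

(* Main.v *)
(* Soundness: a history-preserving isomorphism restricts to the configurations
   obtained by reversing corresponding events, so it preserves reverse-only
   formulas; the bisimulation clauses take care of the forward modality.

   Completeness is a Hennessy-Milner argument: relate X and Y along f when they
   satisfy the same EIL_h formulas under environments naming the events of X and
   their images under f.  If no a-successor of Y matched X -a-> X', image
   finiteness would give one conjunction phi satisfied at X' and refuted by all
   of them, and <x:a>phi would separate X from Y.  That f preserves causality
   needs only formulas <<z1>>...<<zk>>tt: e does not depend on d in X exactly when
   some chain of reversals from X removes d but not e. *)
Require Import Defs.
From mathcomp Require Import all_boot finmap.
From mathcomp Require Import boolp classical_sets functions cardinality.

Set Implicit Arguments.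
Unset Strict Implicit.
Unset Printing Implicit Defensive.

Local Open Scope classical_set_scope.

(** * Induction on finite sets *)

Lemma finite_setD1_ind (T : Type) (P : set T -> Prop) :
  (forall A, finite_set A -> (forall a, A a -> P (A `\ a)) -> P A) ->
  forall A, finite_set A -> P A.
Proof.
(* The cardinality is taken through [fset_set], which asks for a choice structure; classically every
   type carries one. *)
elim/Pchoice: T => T in P *.
move=> IH A; have [n] := ubnP #|` fset_set A|; elim: n A => // n IHn A + Afin.
rewrite ltnS => leAn; apply: IH => // a Aa.
apply: IHn; last exact: finite_setD.
rewrite fset_setD1// (leq_trans _ leAn)//.
by rewrite [ltnRHS](cardfsD1 a) in_fset_set ?mem_set.
Qed.

Lemma setD1_notin (T : Type) (A : set T) a : ~ (A `\ a) a.
Proof. by case=> _; apply. Qed.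

(** * Removable events and causality in stable structures *)

Section StableConfigurations.
Variables (Act : Type) (C : config_struct Act).
Hypothesis stable_C : stable C.
Implicit Types (X Y Z W : set (event C)) (d e : event C).

Lemma event_transP X e X' :
  event_trans X e X' <-> [/\ config C X', X' e, X = X' `\ e & config C X].
Proof.
split=> [[cX cX' XX' XD]|[cX' X'e -> cX]].
  have [X'e Xe] : (X' `\` X) e by rewrite XD.
  split=> //; apply/seteqP; split=> d.
    by move=> Xd; split; [exact: XX'|move=> de; apply: Xe; rewrite -de].
  move=> [X'd de]; apply: contrapT => Xd; apply: de.
  by suff : [set e] d by []; rewrite -XD.
split=> //.
apply/seteqP; split=> [d [X'd dXe]|d ->].
  by apply: contrapT => de; apply: dXe.
by split=> // -[_]; apply.
Qed.

(** [A] is a finite union of configurations, and every partial union stays below [X], so stability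
    keeps it a configuration. The induction runs over finite parts [B] of [A] and ends at
    [B = A]. *)
Lemma config_covered X A : config C X -> A `<=` X ->
  (forall d, A d -> exists Z, [/\ config C Z, Z `<=` A & Z d]) -> config C A.
Proof.
case: stable_C => c0 _ cUI cX AX covA.
suff: forall B, finite_set B -> B `<=` A ->
    exists Z, [/\ config C Z, Z `<=` A & B `<=` Z].
  move=> /(_ A (sub_finite_set AX (config_finite cX)) (fun _ => id))[Z [cZ ZA AZ]].
  by rewrite (_ : A = Z)//; apply/seteqP.
apply: finite_setD1_ind => B _ IH BA.
have [->|/set0P[b Bb]] := eqVneq B set0; first by exists set0; split=> //; exact: sub0set.
have [Z [cZ ZA BZ]] := IH b Bb (fun d Bd => BA d (proj1 Bd)).
have [W [cW WA Wb]] := covA b (BA b Bb).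
exists (Z `|` W); split=> [||d Bd].
- by apply: proj1 (cUI Z W X cZ cW cX _) => d [/ZA|/WA] /AX.
- by move=> d [/ZA|/WA].
- have [->|db] := EM (d = b); [by right|by left; apply: BZ].
Qed.

(** If no [d] lies above [e], each other event of [X] belongs to a configuration inside [X] that
    avoids [e]; these configurations cover [X] without [e]. Removability thus depends on the causal
    order alone. *)
Lemma config_setD1P X e : config C X ->
  (config C (X `\ e) <-> forall d, X d -> ~ causal_lt X e d).
Proof.
move=> cX; split=> [cXe d Xd [le_ed ed]|max_e].
  by apply: (@setD1_notin _ X e); apply: le_ed => [//|? []//|]; split=> // /esym.
apply: (config_covered cX) => [? []//|d [Xd de]].
apply: contrapT => noZ; apply: (max_e d Xd); split; last by move=> ed; apply: de.
move=> Z cZ ZX Zd; apply: contrapT => Ze; apply: noZ; exists Z; split=> //.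
by move=> d' Zd'; split; [exact: ZX|move=> d'e; apply: Ze; rewrite -d'e].
Qed.

(** A configuration [Z] below [X] can be cut down to its intersection with [X'], which is a
    configuration by stability and still contains [e]. *)
Lemma causal_le_sub X X' d e : config C X -> config C X' -> X' `<=` X ->
  X' e -> (causal_le X' d e <-> causal_le X d e).
Proof.
case: stable_C => _ _ cUI cX cX' X'X X'e; split=> le_de Z cZ ZX Ze.
  suff [] : (Z `&` X') d by [].
  apply: le_de => //.
    by apply: proj2 (cUI Z X' X cZ cX' cX _) => d' [/ZX|/X'X].
by apply: le_de => // d' /ZX /X'X.
Qed.

(* Take [W] minimal among the configurations with [W `|` Z = X]: an event that
   can be removed from [W] lies outside [Z] and can be removed from [X]. *)
Lemma config_sub_removable X Z : config C X -> config C Z -> Z `<=` X -> Z <> X ->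
  exists e, [/\ X e, ~ Z e & config C (X `\ e)].
Proof.
case: stable_C => _ rem cUI cX cZ ZX ZneX.
suff: forall W, finite_set W -> config C W -> W `|` Z = X ->
    exists e, [/\ X e, ~ Z e & config C (X `\ e)].
  by move=> /(_ X (config_finite cX) cX); apply; exact: setUidl.
apply: finite_setD1_ind => W _ IH cW WZ.
have [W0|/set0P W0] := eqVneq W set0; first by rewrite W0 set0U in WZ.
have [e We cWe] := rem W cW W0.
have [Weq|Wneq] := EM ((W `\ e) `|` Z = X); first exact: IH We cWe Weq.
have WX : W `<=` X by rewrite -WZ; left.
have nZe : ~ Z e.
  move=> Ze; apply: Wneq; rewrite -WZ; apply/seteqP; split=> d.
    by case=> [[? _]|?]; [left|right].
  by case=> [Wd|?]; [have [->|de] := EM (d = e); [right|left]|right].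
exists e; split=> //; first exact: WX.
have <- : (W `\ e) `|` Z = X `\ e.
  rewrite -WZ; apply/seteqP; split=> d.
    case=> [[? ?]|Zd]; first by split=> //; left.
    by split; [right|move=> de; apply: nZe; rewrite -de].
  by move=> [[Wd|Zd] de]; [left|right].
by apply: proj1 (cUI _ _ _ cWe cZ cX _) => d [[/WX]|/ZX].
Qed.

End StableConfigurations.

(** * Isomorphisms and the invariance of reverse-only formulas *)

Section Isomorphisms.
Variables (Act : Type).

Definition graph_swap (T U : Type) (f : set (T * U)) : set (U * T) :=
  [set p | f (p.2, p.1)].

Lemma config_iso_swap (C D : config_struct Act) (X : set (event C))
    (Y : set (event D)) f : config_iso X Y f -> config_iso Y X (graph_swap f).
Proof.
case=> fXY fX fY lab ord; split=> //.
- by move=> [e' e] /fXY[].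
- by move=> e' e /lab.
- by move=> d' e' d e fd fe; split=> /(ord _ _ _ _ fd fe).
Qed.

Lemma config_iso_inj (C D : config_struct Act) (X : set (event C))
    (Y : set (event D)) f d e e' :
  config_iso X Y f -> f (d, e') -> f (e, e') -> d = e.
Proof.
case=> fXY _ fY _ _ fd fe; have [_ Ye'] := fXY _ fd.
by have [? [_ uni]] := fY _ Ye'; rewrite -(uni d)// -(uni e).
Qed.

Lemma config_iso_fun (C D : config_struct Act) (X : set (event C))
    (Y : set (event D)) f d d' e' :
  config_iso X Y f -> f (d, d') -> f (d, e') -> d' = e'.
Proof. by move=> /config_iso_swap iso fd fe; apply: (config_iso_inj iso fd fe). Qed.

(** Removable events are the causally maximal ones, and [f] preserves the order, so [e'] is
    removable because [e] is. The order of the smaller configurations is the restricted one, so the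
    restriction of [f] is again an isomorphism. *)
Lemma config_iso_reverse (C D : config_struct Act) (X X' : set (event C))
    (Y : set (event D)) f e e' :
  stable C -> stable D -> config D Y -> config_iso X Y f -> f (e, e') ->
  event_trans X' e X ->
  event_trans (Y `\ e') e' Y /\ config_iso X' (Y `\ e') (graph_restr f X').
Proof.
move=> sC sD cY iso fe /event_transP[cX Xe X'E cX'].
have [fXY fX fY lab ord] := iso.
have [_ Ye'] := fXY _ fe.
have cYe : config D (Y `\ e').
  apply/(config_setD1P sD _ cY) => d' Yd' lt_ed.
  have [d [fd _]] := fY d' Yd'.
  have /(config_setD1P sC _ cX) : config C (X `\ e) by rewrite -X'E.
  by move=> /(_ d (proj1 (fXY _ fd))); apply; apply/(ord _ _ _ _ fe fd).
split; first exact/event_transP.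
(* Since [f] is a bijection pairing [e] with [e'], removing both leaves sets that still correspond
   under [f]. *)
have inX' d d' : f (d, d') -> (X' d <-> (Y `\ e') d').
  move=> fd; have [Xd Yd'] := fXY _ fd; rewrite X'E.
  split=> -[_ ne]; split=> //.
    by move=> d'e'; apply: ne; apply: (config_iso_inj iso fd); rewrite d'e'.
  by move=> de; apply: ne; apply: (config_iso_fun iso fd); rewrite de.
split.
- by move=> [d d'] [fd [X'd _]]; split=> //; apply/(inX' _ _ fd).
- move=> d X'd; have [|d' [fd uni]] := fX d; first by move: X'd; rewrite X'E => -[].
  by exists d'; split=> // d'' [/uni].
- move=> d' Yd'; have [|d [fd uni]] := fY d'; first by case: Yd'.
  exists d; split=> [|d'' [/uni//]].
  by split=> //; split=> //; apply/(inX' _ _ fd).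
- by move=> d d' [/lab].
- move=> d1 d2 d1' d2' [f1 [X1 _]] [f2 [X2 _]].
  have X'X : X' `<=` X by rewrite X'E => ? [].
  have Y'Y : Y `\ e' `<=` Y by move=> ? [].
  have := ord _ _ _ _ f1 f2; rewrite /causal_lt.
  have := causal_le_sub sC d1 cX cX' X'X X2.
  have := causal_le_sub sD d1' cY cYe Y'Y (proj1 (inX' _ _ f2) X2).
  by move=> -> ->.
Qed.

Definition related_envs (C D : config_struct Act) (f : set (event C * event D))
    (rho : env C) (rho' : env D) (phi : EIL Act) : Prop :=
  forall x, fi phi x ->
    exists e e', [/\ rho x = Some e, rho' x = Some e' & f (e, e')].

Lemma updateE (C : config_struct Act) (rho : env C) x e :
  update rho x e x = Some e.
Proof. by rewrite /update eqxx. Qed.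

Lemma update_neq (C : config_struct Act) (rho : env C) x y e :
  y <> x -> update rho x e y = rho y.
Proof. by move=> /eqP/negbTE yx; rewrite /update yx. Qed.

Lemma related_envs_update (C D : config_struct Act) (f : set (event C * event D))
    rho rho' phi x e e' :
  (forall y, (fi phi `\ x) y ->
    exists d d', [/\ rho y = Some d, rho' y = Some d' & f (d, d')]) ->
  f (e, e') -> related_envs f (update rho x e) (update rho' x e') phi.
Proof.
move=> rel fe y phiy; have [->|yx] := EM (y = x).
  by exists e, e'; rewrite !updateE.
by rewrite !update_neq//; exact: rel.
Qed.

(** This case arises in the inductions over both sublogics, so the induction hypothesis is made a
    premise. *)
Lemma sat_Declare_iso (C D : config_struct Act) (X : set (event C))
    (Y : set (event D)) f rho rho' x a phi :
  config_iso X Y f -> related_envs f rho rho' (Declare x a phi) ->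
  (forall rho rho', related_envs f rho rho' phi ->
    (sat X rho phi <-> sat Y rho' phi)) ->
  sat X rho (Declare x a phi) <-> sat Y rho' (Declare x a phi).
Proof.
move=> iso rel IH; have [fXY fX fY lab _] := iso; split=> /=.
  move=> [e [Xe ea se]]; have [e' [fe _]] := fX _ Xe.
  exists e'; split; [by case: (fXY _ fe)|by rewrite -(lab _ _ fe)|].
  by apply/IH/se; exact: related_envs_update.
move=> [e' [Ye' ea se]]; have [e [fe _]] := fY _ Ye'.
exists e; split; [by case: (fXY _ fe)|by rewrite (lab _ _ fe)|].
by apply/IH/se; exact: related_envs_update.
Qed.

Lemma sat_ro_iso (C D : config_struct Act) (phi : EIL Act) :
  stable C -> stable D -> EIL_ro phi ->
  forall (X : set (event C)) (Y : set (event D)) f rho rho',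
  config C X -> config D Y -> config_iso X Y f ->
  related_envs f rho rho' phi -> (sat X rho phi <-> sat Y rho' phi).
Proof.
move=> sC sD; elim=> {phi} [|phi _ IH|phi psi _ IH1 _ IH2|x a phi _ IH|x phi _ IH]
  X Y f rho rho' cX cY iso rel.
- by [].
- by have [IHl IHr] := IH _ _ _ _ _ cX cY iso rel; split=> /= ns; [move/IHr|move/IHl].
- have := IH1 _ _ _ rho rho' cX cY iso (fun x phix => rel x (or_introl phix)).
  have := IH2 _ _ _ rho rho' cX cY iso (fun x phix => rel x (or_intror phix)).
  by move=> /= -> ->.
- by apply: (sat_Declare_iso iso rel) => ? ?; exact: IH.
- have [e [e' [rx rx' fe]]] : exists e e', [/\ rho x = Some e, rho' x = Some e' & f (e, e')].
    by apply: rel; right.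
  (* Permissibility puts every event named by a free identifier of [phi] in [X'], so its pair
     survives the restriction. *)
  have rev X' : event_trans X' e X -> permissible rho phi X' ->
      related_envs (graph_restr f X') rho rho' phi.
    move=> _ perm y phiy; have [d [d' [ry ry' fd]]] := rel y (or_introl phiy).
    exists d, d'; split=> //; split=> //; split=> //.
    by have [d2] := perm y phiy; rewrite ry => -[->].
  split=> /=.
  + move=> [X' [d [tr]]]; rewrite rx => -[ed] perm sX'; rewrite -{d}ed in tr.
    have [tr' iso'] := config_iso_reverse sC sD cY iso fe tr.
    have rel' := rev X' tr perm.
    exists (Y `\ e'), e'; split=> //.
      move=> y phiy; have [d [d' [ry ry' fd]]] := rel' y phiy.
      by exists d' => //; have [/(_ _ fd)[]] := iso'.
    apply/(IH _ _ _ rho rho' _ _ iso' rel')/sX'; first by case: tr.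
    by case: tr'.
  + move=> [Y' [d [tr']]]; rewrite rx' => -[ed] perm sY'; rewrite -{d}ed in tr'.
    have [tr _] := config_iso_reverse sD sC cX (config_iso_swap iso) fe tr'.
    (* The swapped graph served only to obtain the transition; the isomorphism comes from [f]
       itself, as the induction hypothesis runs from [C] to [D]. *)
    have [_ iso'] := config_iso_reverse sC sD cY iso fe tr.
    have YE : Y `\ e' = Y' by have /event_transP[_ _ ->] := tr'.
    rewrite YE in iso'.
    (* A free identifier naming [e] on the left would name [e'] on the right, against permissibility
       there. *)
    have perm' : permissible rho phi (X `\ e).
      move=> y phiy; have [d [d' [ry ry' fd]]] := rel y (or_introl phiy).
      exists d => //; have [Xd _] : (X `*` Y) (d, d') by have [/(_ _ fd)] := iso.
      split=> // de; have [d2] := perm y phiy; rewrite ry' => -[<-].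
      rewrite -YE => -[_]; apply; apply: (config_iso_fun iso fd).
      by rewrite de.
    exists (X `\ e), e; split=> //.
    apply/(IH _ _ _ rho rho' _ _ iso' (rev _ tr perm'))/sY'; first by case: tr.
    by case: tr'.
Qed.

End Isomorphisms.

(** * Soundness: bisimulations preserve the logic *)

Section Soundness.
Variables (Act : Type) (C D : config_struct Act).

(** Were the partner of [e] under [f'] not [e'], it would lie in [Y] and already be the partner
    under [f] of an event of [X]; injectivity of [f'] makes that event [e], which is not in [X]. *)
Lemma graph_restr_step (X X' : set (event C)) (Y Y' : set (event D)) f f' e e' :
  config_iso X Y f -> config_iso X' Y' f' -> graph_restr f' X = f ->
  event_trans X e X' -> event_trans Y e' Y' -> f `<=` f' /\ f' (e, e').
Proof.
move=> iso iso' ff' /event_transP[_ X'e XE _] /event_transP[_ _ YE _].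
have ff : f `<=` f' by rewrite -ff' => ? [].
split=> //; have [fXY' fX' _ _ _] := iso'.
have [e2 [fe2 _]] := fX' _ X'e.
suff <- : e2 = e' by [].
apply: contrapT => ne; have Ye2 : Y e2 by rewrite YE; split=> //; case: (fXY' _ fe2).
have [fXY _ fY _ _] := iso; have [d [fd _]] := fY _ Ye2.
have de := config_iso_inj iso' (ff _ fd) fe2.
by have [] := fXY _ fd; rewrite /= de XE => -[_]; case.
Qed.

Lemma sat_h_bisim (R : set (event C) -> set (event D) ->
    set (event C * event D) -> Prop) phi :
  stable C -> stable D -> H_bisimulation R -> EIL_h phi ->
  forall X Y f rho rho', R X Y f ->
  related_envs f rho rho' phi -> (sat X rho phi <-> sat Y rho' phi).
Proof.
move=> sC sD [Rconf _ Rstep].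
have Riso X Y f (r : R X Y f) : config_iso X Y f.
  (* For empty [Act] the bisimulation clauses are void, but so is [event]. *)
  have [[a]|noA] := EM (inhabited Act); first by have [] := Rstep X Y f a r.
  have noC (e : event C) : False by apply: noA; exact: inhabits (label e).
  have noD (e : event D) : False by apply: noA; exact: inhabits (label e).
  by split=> [[e e'] _|e|e|e|e]; exfalso; exact: noC e || exact: noD e.
elim=> {phi} [|phi _ IH|phi psi _ IH1 _ IH2|x a phi _ IH|x a phi _ IH|phi ro]
  X Y f rho rho' r rel.
- by [].
- by have [IHl IHr] := IH _ _ _ _ _ r rel; split=> /= ns; [move/IHr|move/IHl].
- have := IH1 _ _ _ rho rho' r (fun x phix => rel x (or_introl phix)).
  have := IH2 _ _ _ rho rho' r (fun x phix => rel x (or_intror phix)).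
  by move=> /= -> ->.
- have [iso fwd bwd] := Rstep X Y f a r.
  have step X' Y' f' e e' : R X' Y' f' -> graph_restr f' X = f ->
      event_trans X e X' -> event_trans Y e' Y' ->
      related_envs f' (update rho x e) (update rho' x e') phi.
    move=> r' ff' tr tr'.
    have [ff fe] := graph_restr_step iso (Riso _ _ _ r') ff' tr tr'.
    apply: related_envs_update => // y /rel[d [d' [? ? ?]]].
    by exists d, d'; split=> //; exact: ff.
  split=> /= -[Z [e [tr ea se]]].
    have [|Y' [f' [[e' tr' e'a] r' ff']]] := fwd Z; first by exists e.
    by exists Y', e'; split=> //; apply/IH/se; eauto.
  have [|X' [f' [[e' tr' e'a] r' ff']]] := bwd Z; first by exists e.
  by exists X', e'; split=> //; apply/IH/se; eauto.
- apply: (sat_Declare_iso (Riso _ _ _ r) rel) => ? ?; exact: IH.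
- by have [cX cY] := Rconf _ _ _ r; exact: sat_ro_iso (Riso _ _ _ r) rel.
Qed.

End Soundness.

(** * Formulas for chains of reversals *)

Definition undo (Act : Type) (s : seq ident) : EIL Act :=
  foldr (@Reverse Act) Tt s.

Lemma EIL_ro_undo (Act : Type) s : EIL_ro (undo Act s).
Proof. by elim: s => [|x s IH]; constructor. Qed.

Lemma fi_undo (Act : Type) s : fi (undo Act s) = [set` s].
Proof.
elim: s => [|x s /= ->]; first by apply/seteqP; split.
apply/seteqP; split=> y /=; rewrite inE.
  by case=> [->|->]; rewrite ?eqxx ?orbT.
by case/orP => [/eqP|]; [right|left].
Qed.

(** * Naming the events of a configuration *)

Section Enumerations.
Variables (Act : Type) (C : config_struct Act).
Implicit Types (rho : env C) (X Z : set (event C)).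

(** A bijection from the identifiers below [n] onto [X], so that [n] is always a fresh name. *)
Definition enumerates n rho X : Prop :=
  [/\ forall x, (x < n)%N <-> exists e, rho x = Some e,
      forall e, X e <-> exists x, rho x = Some e
    & forall x y e, rho x = Some e -> rho y = Some e -> x = y].

Lemma enumerates_empty : enumerates 0 (@empty_env _ C) set0.
Proof. by split=> // [x|e]; split=> // -[]. Qed.

(** The identifier [n] names nothing yet, and no old identifier names [e], which lies outside
    [X]. *)
Lemma enumerates_update n rho X X' e : enumerates n rho X ->
  event_trans X e X' -> enumerates n.+1 (update rho n e) X'.
Proof.
move=> [dom ran inj] /event_transP[_ X'e XE _].
have ltn_n x d : rho x = Some d -> (x < n)%N by move=> rx; apply/dom; exists d.
have ne x d : rho x = Some d -> x <> n.
  by move=> /ltn_n lt xn; rewrite xn ltnn in lt.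
have ne_e x d : rho x = Some d -> d <> e.
  move=> rx de; have : X d by apply/ran; exists x.
  by rewrite XE => -[_]; apply.
split.
- move=> x; rewrite ltnS leq_eqVlt; split.
    case/orP=> [/eqP ->|]; first by exists e; rewrite updateE.
    move=> /[dup] xn /dom[d rx]; exists d; rewrite update_neq//.
    exact: ne rx.
  move=> [d]; have [->|xn] := EM (x = n); first by rewrite eqxx.
  by rewrite update_neq// => /ltn_n ->; rewrite orbT.
- move=> d; split=> [X'd|[x]].
    have [->|de] := EM (d = e); first by exists n; rewrite updateE.
    have /ran[x rx] : X d by rewrite XE.
    by exists x; rewrite update_neq//; exact: ne rx.
  have [->|xn] := EM (x = n); first by rewrite updateE => -[<-].
  rewrite update_neq// => rx.
  by have : X d by [apply/ran; exists x]; rewrite XE => -[].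
- move=> x y d; have [->|xn] := EM (x = n); have [->|yn] := EM (y = n) => //.
  + by rewrite updateE update_neq// => -[<-] /ne_e.
  + by rewrite updateE update_neq// => /ne_e + [ed]; rewrite ed.
  + by rewrite !update_neq//; exact: inj.
Qed.

Definition named rho (s : seq ident) : set (event C) :=
  [set e | exists2 x, x \in s & rho x = Some e].

Lemma named_nil rho : named rho [::] = set0.
Proof. by apply/seteqP; split=> [e []|]. Qed.

Lemma named_cons rho x s e :
  rho x = Some e -> named rho (x :: s) = e |` named rho s.
Proof.
move=> rx; apply/seteqP; split=> d.
  move=> [y]; rewrite inE => /orP[/eqP ->|ys ry]; last by right; exists y.
  by rewrite rx => -[->]; left.
case=> [->|[y ys ry]]; first by exists x; rewrite ?mem_head.
by exists y => //; rewrite inE ys orbT.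
Qed.

(** As long as [X] differs from [Z], some event outside [Z] can be removed; [s] lists the names of
    the removed events in order. The first clause yields permissibility at each reversal. *)
Lemma sub_config_undo rho X Z : stable C -> config C X -> config C Z -> Z `<=` X ->
  (forall e, X e -> exists x, rho x = Some e) ->
  exists s, [/\ named rho s `<=` X, forall x, x \in s -> exists e, rho x = Some e,
    Z = X `\` named rho s & sat X rho (undo Act s)].
Proof.
move=> sC cX cZ; have Xfin := config_finite cX; move: X Xfin cX.
apply: finite_setD1_ind => X _ IH cX ZX cov.
have [->|ZneX] := EM (Z = X).
  by exists [::]; rewrite named_nil setD0; split=> //; exact: sub0set.
have [e [Xe Ze cXe]] := config_sub_removable sC cX cZ ZX ZneX.
have [||s [sX sdom ZE ssat]] := IH e Xe cXe.
- by move=> d Zd; split; [exact: ZX|move=> de; apply: Ze; rewrite -de].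
- by move=> d [/cov].
have [x rx] := cov e Xe.
exists (x :: s); split.
- by rewrite (named_cons _ rx) => d [->//|/sX[]].
- by move=> y; rewrite inE => /orP[/eqP ->|/sdom//]; exists e.
- by rewrite ZE (named_cons _ rx) setDDl.
- exists (X `\ e), e; split=> //; first exact/event_transP.
  move=> y; rewrite fi_undo => ys; have [d ry] := sdom y ys.
  by exists d => //; apply: sX; exists y.
Qed.

(** Each reversal has a unique outcome, so the chain must end in [X] without the events named by
    [s]. *)
Lemma sat_undo_config rho X s :
  config C X -> sat X rho (undo Act s) -> config C (X `\` named rho s).
Proof.
elim: s X => [|x s IH] X cX /=.
  by rewrite named_nil setD0.
move=> [X' [e [/event_transP[_ _ X'E cX'] rx _]]] /(IH _ cX').
by rewrite (named_cons _ rx) -setDDl -X'E.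
Qed.

End Enumerations.

(** * Completeness: logical equivalence yields a bisimulation *)

Section Completeness.
Variable Act : Type.

(** The bound on free identifiers makes environments that enumerate [X] and [Y] with names below [n]
    permissible for every formula compared. *)
Definition h_equiv (C D : config_struct Act) n (X : set (event C)) (rho : env C)
    (Y : set (event D)) (rho' : env D) : Prop :=
  forall phi, EIL_h phi -> fi phi `<=` `I_n -> (sat X rho phi <-> sat Y rho' phi).

Definition same_labels (C D : config_struct Act) (rho : env C) (rho' : env D) :=
  forall x e e', rho x = Some e -> rho' x = Some e' -> label e = label e'.

Definition env_graph (C D : config_struct Act) (rho : env C) (rho' : env D) :
    set (event C * event D) :=
  [set p | exists x, rho x = Some p.1 /\ rho' x = Some p.2].

(* Fixing the names of the events in advance, the next one being called [n],
   makes capture-avoiding renaming of formulas unnecessary. *)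
Definition env_match (C D : config_struct Act) n (X : set (event C)) (rho : env C)
    (Y : set (event D)) (rho' : env D) : Prop :=
  [/\ config C X /\ config D Y, enumerates n rho X, enumerates n rho' Y,
      same_labels rho rho' & h_equiv n X rho Y rho'].

Lemma env_match_sym (C D : config_struct Act) n (X : set (event C)) (rho : env C)
    (Y : set (event D)) (rho' : env D) :
  env_match n X rho Y rho' -> env_match n Y rho' X rho.
Proof.
case=> [[cX cY] eX eY lab eqv]; split=> //.
  by move=> x e e' rx rx'; rewrite (lab x e' e).
by move=> phi hphi fphi; split=> /(eqv phi hphi fphi).
Qed.

Lemma env_match_dom (C D : config_struct Act) n (X : set (event C)) (rho : env C)
    (Y : set (event D)) (rho' : env D) x e :
  env_match n X rho Y rho' -> rho x = Some e -> exists e', rho' x = Some e'.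
Proof.
by move=> [_ [dom _ _] [dom' _ _] _ _] rx; apply/dom'/dom; exists e.
Qed.

(* If [Z] is a configuration below [X] containing [e] but not [d], the formula
   that undoes [X] down to [Z] transfers to [Y] and separates [e'] from [d']. *)
Lemma env_match_causal_le (C D : config_struct Act) n (X : set (event C))
    (rho : env C) (Y : set (event D)) (rho' : env D) x y d e d' e' :
  stable C -> env_match n X rho Y rho' ->
  rho x = Some d -> rho y = Some e -> rho' x = Some d' -> rho' y = Some e' ->
  causal_le Y d' e' -> causal_le X d e.
Proof.
move=> sC [[cX cY] [dom ran inj] [dom' ran' inj'] _ eqv] rx ry rx' ry' le_de.
move=> Z cZ ZX Ze; have [s [sX sdom ZE ssat]] : exists s,
    [/\ named rho s `<=` X, forall x, x \in s -> exists e, rho x = Some e,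
      Z = X `\` named rho s & sat X rho (undo Act s)].
  by apply: sub_config_undo => // z /ran.
have ssat' : sat Y rho' (undo Act s).
  apply/(eqv _ (h_ro (EIL_ro_undo Act s)))/ssat.
  by rewrite fi_undo => z /sdom/dom.
have [] : (Y `\` named rho' s) d'.
  apply: le_de; [exact: sat_undo_config|by move=> ? []|].
  split; first by apply/ran'; exists y.
  move=> [z zs rz']; have yz := inj' _ _ _ ry' rz'.
  by move: Ze; rewrite ZE => -[_]; apply; exists y => //; rewrite yz.
move=> _ nd'; rewrite ZE; split; first by apply/ran; exists x.
move=> [z zs rz]; apply: nd'; exists x => //.
by rewrite (inj _ _ _ rx rz).
Qed.

(** Both environments are injective with the same domain, so pairing events by name is a bijection.
    Each direction of the order uses the transfer of causality from one side of the match. *)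
Lemma env_match_iso (C D : config_struct Act) n (X : set (event C))
    (rho : env C) (Y : set (event D)) (rho' : env D) :
  stable C -> stable D -> env_match n X rho Y rho' ->
  config_iso X Y (env_graph rho rho').
Proof.
move=> sC sD m; have m' := env_match_sym m.
have [_ [dom ran inj] [dom' ran' inj'] lab _] := m; split.
- by move=> [e e'] [x [rx rx']]; split=> /=; [apply/ran|apply/ran']; exists x.
- move=> e /ran[x rx]; have [e' rx'] := env_match_dom m rx.
  exists e'; split=> [|e2 [y [/= ry]]]; first by exists x.
  by rewrite (inj _ _ _ ry rx) rx' => -[].
- move=> e' /ran'[x rx']; have [e rx] := env_match_dom m' rx'.
  exists e; split=> [|e2 [y [/= + ry']]]; first by exists x.
  by rewrite (inj' _ _ _ ry' rx') rx => -[].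
- by move=> e e' [x [rx rx']]; exact: lab rx rx'.
- move=> d e d' e' [x [/= rx rx']] [y [/= ry ry']]; split=> -[le ne]; split.
  + exact: env_match_causal_le sD m' rx' ry' rx ry le.
  + move=> de; apply: ne; rewrite de in rx'; move: rx.
    by rewrite (inj' _ _ _ rx' ry') ry => -[].
  + exact: env_match_causal_le sC m rx ry rx' ry' le.
  + move=> de; apply: ne; rewrite de in rx; move: rx'.
    by rewrite (inj _ _ _ rx ry) ry' => -[].
Qed.

(** The formula is the conjunction of the separating formulas, one for each element of the finite
    set [A]. *)
Lemma h_distinguish (C : config_struct Act) n (X : set (event C)) rho
    (T : Type) (A : set T) (refuted : T -> EIL Act -> Prop) :
  (forall t phi psi, refuted t phi \/ refuted t psi -> refuted t (And phi psi)) ->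
  finite_set A ->
  (forall t, A t -> exists phi,
    [/\ EIL_h phi, fi phi `<=` `I_n, sat X rho phi & refuted t phi]) ->
  exists phi, [/\ EIL_h phi, fi phi `<=` `I_n, sat X rho phi
    & forall t, A t -> refuted t phi].
Proof.
move=> rand; move: A; apply: finite_setD1_ind => A _ IH dist.
have [->|/set0P[t At]] := eqVneq A set0.
  by exists Tt; split=> //; constructor.
have [|phi [hphi fphi sphi rphi]] := IH t At; first by move=> u [/dist].
have [psi [hpsi fpsi spsi rpsi]] := dist t At.
exists (And phi psi); split=> //; first exact: h_And.
  by move=> x [/fphi|/fpsi].
move=> u Au; apply: rand; have [->|ut] := EM (u = t); [by right|left].
by apply: rphi.
Qed.

Lemma env_match_step (C D : config_struct Act) n (X X' : set (event C))
    (rho : env C) (Y : set (event D)) (rho' : env D) e :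
  image_finite D -> env_match n X rho Y rho' -> event_trans X e X' ->
  exists Y' e', [/\ event_trans Y e' Y', label e' = label e &
    env_match n.+1 X' (update rho n e) Y' (update rho' n e')].
Proof.
move=> ifD [[cX cY] eX eY lab eqv] tr; have [_ cX' _ _] := tr.
suff [Y' [e' [tr' lab' eqv']]] : exists Y' e',
    [/\ event_trans Y e' Y', label e' = label e &
      h_equiv n.+1 X' (update rho n e) Y' (update rho' n e')].
  exists Y', e'; split=> //; split=> //; first by case: tr'.
  - exact: enumerates_update tr.
  - exact: enumerates_update tr'.
  - move=> x d d'; have [->|xn] := EM (x = n).
      by rewrite !updateE => -[<-] [<-].
    by rewrite !update_neq//; exact: lab.
apply: contrapT => nomatch.
(* Image finiteness counts target configurations, not events, so the event is quantified inside; it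
   is determined by [Y] and [Y'] anyway. *)
pose refuted Y' phi := forall e', event_trans Y e' Y' ->
  label e' = label e -> ~ sat Y' (update rho' n e') phi.
have [||Y' [e' tr' lab']|phi [hphi fphi sphi rphi]] :=
  @h_distinguish C n.+1 X' (update rho n e) _
    [set Y' | label_trans Y (label e) Y'] refuted.
- by move=> Y' phi psi [] r e' tr' lab' /= [s1 s2]; exact: (r e').
- exact: ifD.
- have [phi [hphi fphi nphi]] : exists phi, [/\ EIL_h phi, fi phi `<=` `I_n.+1 &
      ~ (sat X' (update rho n e) phi <-> sat Y' (update rho' n e') phi)].
    apply: contrapT => nophi; apply: nomatch; exists Y', e'; split=> //.
    move=> phi hphi fphi; apply: contrapT => nphi.
    by apply: nophi; exists phi.
  have uniq e2 : event_trans Y e2 Y' -> e2 = e'.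
    case: tr' => _ _ _ Ee' [_ _ _ Ee2].
    have : [set e2] e2 by [].
    by rewrite -Ee2 Ee'.
  (* Negating if necessary, the separating formula can be taken true at [X']. *)
  have [s|ns] := EM (sat X' (update rho n e) phi).
    exists phi; split=> // e2 /uniq -> _ s'; by apply: nphi; split.
  exists (Neg phi); split=> //; first exact: h_Neg.
  by move=> e2 /uniq -> _ /= ns'; apply: nphi; split=> [/ns|/ns'].
(* Binding [n] brings the free identifiers back below [n], so the equivalence of [X] and [Y] applies
   and gives a successor of [Y] that satisfies [phi]. *)
- have : sat X rho (Forward n (label e) phi) by exists X', e.
  move=> /(proj1 (eqv _ (h_Forward n (label e) hphi) _))[].
    move=> x [/fphi /= + xn]; rewrite ltnS leq_eqVlt => /orP[/eqP//|//].
  by move=> Y' [e' [tr' lab' s']]; apply: (rphi Y') s' => //; exists e'.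
Qed.

(** The only new pair is that of [e] and [e'], and [e] lies outside [X]. *)
Lemma env_graph_restr (C D : config_struct Act) n (X X' : set (event C))
    (rho : env C) (Y : set (event D)) (rho' : env D) e e' :
  env_match n X rho Y rho' -> event_trans X e X' ->
  graph_restr (env_graph (update rho n e) (update rho' n e')) X = env_graph rho rho'.
Proof.
move=> [_ [dom ran inj] [dom' _ _] _ _] /event_transP[_ _ XE _].
have ne x d : rho x = Some d -> x <> n.
  move=> rx xn; have : (x < n)%N by apply/dom; exists d.
  by rewrite xn ltnn.
apply/seteqP; split=> -[d d'].
  move=> [[x [/= + +]] [/= Xd _]]; have [->|xn] := EM (x = n).
    by rewrite updateE => -[ed]; move: Xd; rewrite XE -ed => -[_]; case.
  by rewrite !update_neq// => rx rx'; exists x.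
move=> [x [/= rx rx']]; split; last by split=> //; apply/ran; exists x.
by exists x; rewrite !update_neq//; exact: ne rx.
Qed.

Lemma h_equiv_bisimilar (C D : config_struct Act) :
  stable C -> stable D -> image_finite C -> image_finite D ->
  logic_equiv (@EIL_h Act) C D -> H_bisimilar C D.
Proof.
move=> sC sD ifC ifD eqv.
exists (fun X Y f => exists n rho rho',
  env_match n X rho Y rho' /\ f = env_graph rho rho'); split.
- by move=> X Y f [n [rho [rho' [[]]]]].
- exists 0, (@empty_env _ C), (@empty_env _ D); split.
    split=> //; [by case: sC; case: sD|exact: enumerates_empty
      |exact: enumerates_empty|].
    (* With no name assigned yet, the bound on free identifiers says that the formula is closed. *)
    move=> phi hphi fphi; apply: eqv => //; rewrite /closed_formula -subset0.
    by move=> x /fphi.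
  by apply/seteqP; split=> // p [x []].
- move=> X Y f a [n [rho [rho' [m ->]]]]; split; first exact: env_match_iso m.
  + move=> X' [e tr ea].
    have [Y' [e' [tr' lab' m']]] := env_match_step ifD m tr.
    exists Y', (env_graph (update rho n e) (update rho' n e')); split.
    * by exists e' => //; rewrite lab'.
    * by exists n.+1, (update rho n e), (update rho' n e').
    * exact: env_graph_restr m tr.
  + move=> Y' [e' tr' ea].
    have [X' [e [tr lab' m']]] := env_match_step ifC (env_match_sym m) tr'.
    exists X', (env_graph (update rho n e) (update rho' n e')); split.
    * by exists e => //; rewrite lab'.
    * exists n.+1, (update rho n e), (update rho' n e'); split=> //.
      exact: env_match_sym.
    * exact: env_graph_restr m tr.
Qed.

End Completeness.

Theorem theorem2 (Act : Type) (C D : config_struct Act)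
  (stable_C : stable C) (stable_D : stable D)
  (image_finite_C : image_finite C) (image_finite_D : image_finite D) :
  H_bisimilar C D <-> logic_equiv (@EIL_h Act) C D.
Proof.
split; last exact: h_equiv_bisimilar.
move=> [R HR] phi hphi cphi; have [_ R0 _] := HR.
by apply: (sat_h_bisim stable_C stable_D HR hphi R0) => x; rewrite cphi.
Qed.
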